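(* Let $\ell\ge 1$ and let $G$ be a finite subgraph of the $\mathbb{Z}^\ell$ lattice with $n$ vertices. Then \[\operatorname{pd}(G)\le n\left(1-\frac{1}{2\ell+1}\right).\]
   Context: The $\mathbb{Z}^\ell$ lattice is the infinite graph whose vertices are the points of $\mathbb{R}^\ell$ with integer coordinates, two vertices being adjacent when they are at Euclidean distance $1$. For a finite simple graph $G$ with vertex set $\{x_1,\dots,x_n\}$ and a fixed field $\mathbf{k}$, $S=\mathbf{k}[x_1,\dots,x_n]$, $I(G)=(x_ix_j:(x_i,x_j)\in E(G))$ is the edge ideal, and $\operatorname{pd}(G)$ is the projective dimension of $S/I(G)$. *)

(* Defs.v *)
From HB Require Import structures.
From mathcomp Require Import all_boot all_order all_algebra.
From mathcomp Require Import mpoly.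
Set Implicit Arguments. Unset Strict Implicit. Unset Printing Implicit Defensive.
Import Order.TTheory GRing.Theory Num.Theory.
Local Open Scope ring_scope.

Definition lattice_adj (l : nat) (p q : {ffun 'I_l -> int}) : bool :=
  \sum_(c < l) (p c - q c) ^+ 2 == 1.

Definition in_edge_ideal (k : fieldType) (n : nat) (e : rel 'I_n)
  (f : {mpoly k[n]}) : Prop :=
  exists c : 'I_n -> 'I_n -> {mpoly k[n]},
    f = \sum_(i < n) \sum_(j < n | e i j) c i j * 'X_i * 'X_j.

(* A finite free resolution of S/I(G) of length <= p:
     0 -> ... -> F_2 --d 0--> F_1 --g--> F_0 = S -> S/I(G) -> 0
   with F_{i+1} = S^(r i) (row vectors, maps act by right multiplication),
   F_{i+1} = 0 for i >= p, image of g equal to I(G), and exactness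
   at every F_j with j >= 1. *)
Definition free_resolution (k : fieldType) (n : nat) (e : rel 'I_n) (p : nat)
  (r : nat -> nat) (g : 'M[{mpoly k[n]}]_(r 0, 1))
  (d : forall i, 'M[{mpoly k[n]}]_(r i.+1, r i)) : Prop :=
  (forall i, (p <= i)%N -> r i = 0%N) /\
      (forall f, in_edge_ideal e f <-> exists v : 'rV_(r 0), f = (v *m g) 0 0) /\
      d 0%N *m g = 0 /\
      (forall i, d i.+1 *m d i = 0) /\
      (forall v : 'rV_(r 0), v *m g = 0 -> exists w : 'rV_(r 1), v = w *m d 0%N) /\
      (forall i (v : 'rV_(r i.+1)), v *m d i = 0 ->
         exists w : 'rV_(r i.+2), v = w *m d i.+1).

Definition pd_le (k : fieldType) (n : nat) (e : rel 'I_n) (p : nat) : Prop :=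
  exists (r : nat -> nat) (g : 'M[{mpoly k[n]}]_(r 0, 1))
         (d : forall i, 'M[{mpoly k[n]}]_(r i.+1, r i)),
    free_resolution e p g d.

(* Main.v *)
(** For a vertex x of a graph on W, the ideal J = I(W) equals B + xA, where
    B = I(W - x) and A = (J : x) is generated by the neighbours of x together
    with I(W - N[x]).  Since x is regular modulo B, J is an extension of B/xB
    by xA, and the horseshoe construction yields
    pd(W) <= max(pd(W - N[x]) + deg x, pd(W - x) + 1).

    For a lattice graph let y maximise the functional sum_c (l - c) pos_c.  Its
    neighbours are then of the form y - e_c; delete them in increasing order of
    c.  The neighbour y - e_c has no neighbour y - e_c + e_j with j < c, hence
    degree at most 2l - c, and at most c vertices precede it.  So splitting off
    its closed neighbourhood costs r <= 2l in projective dimension, counting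
    the deleted vertices, and removes r + 1 vertices.  Once all of them are
    deleted y is isolated and leaves for free, with the same balance. *)
Require Import Defs.
From mathcomp Require Import mpoly zify.
From mathcomp Require Import all_boot all_order all_algebra.

Set Implicit Arguments.
Unset Strict Implicit.
Unset Printing Implicit Defensive.
Import Order.TTheory GRing.Theory Num.Theory.
Local Open Scope ring_scope.

(** * Finite free resolutions as iterated syzygy matrices *)

Definition syzygy (R : comNzRingType) s r m (N : 'M[R]_(s, r))
    (M : 'M[R]_(r, m)) : Prop :=
  forall v : 'rV_r, v *m M = 0 <-> exists w : 'rV_s, v = w *m N.

(** The index [p] bounds the length of a free resolution of the cokernel of [M], with [R^r] as its
    first term after [R^m]. For a column of generators of an ideal [I] this is a bound on the
    projective dimension of [R/I], not of [I]. *)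
Fixpoint resolvable (R : comNzRingType) (p r m : nat) (M : 'M[R]_(r, m)) :
    Prop :=
  if p is p'.+1 then
    exists s (N : 'M[R]_(s, r)), syzygy N M /\ resolvable p' N
  else r = 0%N.

Section Resolutions.
Variable R : comNzRingType.

Lemma syzygy_mul0 s r m (N : 'M[R]_(s, r)) (M : 'M_(r, m)) :
  syzygy N M -> N *m M = 0.
Proof.
move=> NM; apply/row_matrixP => i; rewrite row_mul row0.
by apply/NM; exists (delta_mx 0 i); rewrite rowE.
Qed.

Lemma row_factor s r m (X : 'M[R]_(s, m)) (Y : 'M_(r, m)) :
  (forall i, exists w : 'rV_r, row i X = w *m Y) -> exists Z, X = Z *m Y.
Proof.
move=> /fin_all_exists [f fP]; exists (\matrix_i f i).
by apply/row_matrixP => i; rewrite row_mul rowK fP.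
Qed.

Lemma rV0E r (v : 'rV[R]_r) : r = 0%N -> v = 0.
Proof. by move=> r0; subst r; rewrite thinmx0. Qed.

Lemma resolvableS p r m (M : 'M[R]_(r, m)) :
  resolvable p M -> resolvable p.+1 M.
Proof.
elim: p r m M => [|p IHp] r m M /=.
  move=> r0; exists 0%N, 0; split=> // v; split=> _.
    by exists 0; rewrite mulmx0 (rV0E v r0).
  by rewrite (rV0E v r0) mul0mx.
by case=> s [N [NM /IHp resN]]; exists s, N.
Qed.

Lemma resolvable_leq p q r m (M : 'M[R]_(r, m)) :
  (p <= q)%N -> resolvable p M -> resolvable q M.
Proof.
move=> le_pq resM; rewrite -(subnK le_pq).
by elim: (q - p)%N => // d IHd; rewrite addSn; apply: resolvableS.
Qed.

(* The hypothesis on [T] says that the connecting map vanishes, so that the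
   horseshoe construction applies at every stage. *)
Lemma resolvable_block p rQ rP mQ mP (Q : 'M[R]_(rQ, mQ)) (T : 'M_(rQ, mP))
    (P : 'M_(rP, mP)) :
  (forall v : 'rV_rQ, v *m Q = 0 -> exists w : 'rV_rP, v *m T = w *m P) ->
  resolvable p Q -> resolvable p P -> resolvable p (block_mx Q T 0 P).
Proof.
elim: p rQ rP mQ mP Q T P => [|p IHp] rQ rP mQ mP Q T P kerT /=.
  by move=> -> ->.
case=> sQ [Q' [Q'Q resQ]] [sP [P' [P'P resP]]].
have Q'Q0 := syzygy_mul0 Q'Q; have P'P0 := syzygy_mul0 P'P.
(* [T'] lifts [- Q' T] through [P]; the sign makes the product of the two block matrices vanish. *)
have [T' T'P] : exists T', - (Q' *m T) = T' *m P.
  apply: row_factor => i.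
  have [|w wP] := kerT (row i Q'); first by rewrite -row_mul Q'Q0 row0.
  by exists (- w); rewrite linearN /= row_mul wP mulNmx.
exists (sQ + sP)%N, (block_mx Q' T' 0 P'); split; last first.
  (* At later stages the kernel condition is automatic: [v Q' = 0] gives [v T' P = - v Q' T = 0], so
     [v T'] lies in the image of [P']. *)
  apply: IHp resQ resP => v vQ'0.
  by apply/P'P; rewrite -mulmxA -T'P mulmxN mulmxA vQ'0 mul0mx oppr0.
move=> v; split=> [|[w ->]]; last first.
  rewrite -mulmxA mulmx_block Q'Q0 P'P0 -T'P !mul0mx !mulmx0 !addr0.
  by rewrite subrr -[block_mx 0 0 0 0]/(block_mx _ _ _ _) block_mx0 mulmx0.
rewrite -[v]hsubmxK mul_row_block mulmx0 addr0 -row_mx0.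
move=> /eq_row_mx [/Q'Q [w vE] uE].
have /P'P [z zE] : (rsubmx v - w *m T') *m P = 0.
  rewrite mulmxBl -mulmxA -T'P mulmxN opprK mulmxA -vE addrC; exact: uE.
exists (row_mx w z); rewrite mul_row_block mulmx0 addr0 -vE -zE.
by rewrite addrC subrK.
Qed.

(* The image of [col_mx x%:M N] is [x F + ker M], the first syzygy module of
   [im M / x im M]. *)
Lemma resolvable_quotient (x : R) p r m (M : 'M[R]_(r, m)) :
  GRing.lreg x -> resolvable p M ->
  exists s (N : 'M[R]_(s, r)),
    syzygy N M /\ resolvable p (col_mx x%:M N).
Proof.
move=> x_reg; case: p => [|p] /=.
  move=> r0; subst r; exists 0%N, 0; split=> // v; split=> _.
    by exists 0; rewrite !thinmx0.
  by rewrite (thinmx0 v) mul0mx.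
case=> s [N [NM resN]]; exists s, N; split=> //.
have NM0 := syzygy_mul0 NM.
have [s' [N' [N'N resN']]] := resolvableS resN.
(* Mapping cone of multiplication by [x]: the relations are [N x - x N = 0] and the syzygies [N'] of
   [N]. *)
exists (s + s')%N, (block_mx N (- x%:M) 0 N'); split; last first.
  apply: resolvable_block => // v vN0; apply/N'N.
  by rewrite mulmxN mul_mx_scalar mulNmx -scalemxAl vN0 scaler0 oppr0.
have N'N0 := syzygy_mul0 N'N.
move=> v; split=> [|[w ->]]; last first.
  rewrite -mulmxA mul_block_col mul_mx_scalar mulNmx mul_scalar_mx subrr.
  by rewrite mul0mx add0r N'N0 col_mx0 mulmx0.
rewrite -[v]hsubmxK mul_row_col mul_mx_scalar => vE.
have /NM [w wE] : lsubmx v *m M = 0.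
  have : x *: (lsubmx v *m M) = 0.
    have := congr1 (mulmx^~ M) vE.
    by rewrite /= mulmxDl -mulmxA NM0 mulmx0 addr0 mul0mx -scalemxAl.
  move=> /matrixP xvM; apply/matrixP => i j; apply: x_reg.
  by have := xvM i j; rewrite !mxE mulr0.
have /N'N [z zE] : (x *: w + rsubmx v) *m N = 0.
  by rewrite mulmxDl -scalemxAl -wE.
exists (row_mx w z).
by rewrite mul_row_block mulmx0 addr0 -wE -zE mulmxN mul_mx_scalar addKr.
Qed.

(* With A = im gA and B = im gB this resolves B + xA, an extension of B/xB by
   xA; the last hypothesis says that x is regular modulo B. *)
Lemma resolvable_colon (x : R) p rA rB m (gA : 'M[R]_(rA, m))
    (gB : 'M_(rB, m)) :
  GRing.lreg x -> (exists F, gB = F *m gA) ->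
  (forall (v : 'rV_rB) (u : 'rV_rA), v *m gB = x *: (u *m gA) ->
     exists w : 'rV_rB, u *m gA = w *m gB) ->
  resolvable p.+1 gA -> resolvable p gB ->
  resolvable p.+1 (col_mx gB (x *: gA)).
Proof.
move=> x_reg [F FE] colonB [sA [P [PA resP]]].
move=> /(resolvable_quotient x_reg) [s [N [NB resN]]].
have PA0 := syzygy_mul0 PA; have NB0 := syzygy_mul0 NB.
(* Three kinds of relations: [x gB = F (x gA)], the syzygies [N] of [gB] and the syzygies [P] of
   [gA]. *)
exists (rB + s + sA)%N, (block_mx (col_mx x%:M N) (col_mx (- F) 0) 0 P).
split; last first.
  apply: resolvable_block => // v; rewrite -[v]hsubmxK !mul_row_col.
  rewrite mul_mx_scalar mulmx0 addr0 => vE; apply/PA.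
  rewrite -mulmxA mulNmx -FE mulmxN.
  suff -> : lsubmx v *m gB = 0 by rewrite oppr0.
  have /matrixP xvM : x *: (lsubmx v *m gB) = 0.
    have := congr1 (mulmx^~ gB) vE.
    by rewrite /= mulmxDl -mulmxA NB0 mulmx0 addr0 mul0mx -scalemxAl.
  by apply/matrixP => i j; apply: x_reg; have := xvM i j; rewrite !mxE mulr0.
move=> v; split=> [|[w ->]]; last first.
  rewrite -mulmxA mul_block_col !mul_col_mx mul_scalar_mx NB0 mul0mx.
  rewrite -!scalemxAr PA0 scaler0 mul0mx add0r mulNmx -FE scalerN.
  by rewrite add_col_mx subrr addr0 col_mx0 col_mx0 mulmx0.
rewrite -[v]hsubmxK mul_row_col -scalemxAr => /eqP.
set v1 := lsubmx v; set u := rsubmx v.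
rewrite addr_eq0 -scalerN -mulNmx => /eqP vE.
have [w wE] := colonB _ _ vE.
have /NB [t tE] : (v1 - x *: w) *m gB = 0.
  by rewrite mulmxBl vE wE -scalemxAl subrr.
have /PA [z zE] : (u + w *m F) *m gA = 0.
  by rewrite mulmxDl -mulmxA -FE -wE mulNmx subrr.
exists (row_mx (row_mx w t) z).
rewrite mul_row_block !mul_row_col mul_mx_scalar !mulmx0 !addr0 -tE -zE.
by rewrite addrC subrK mulmxN addrC addrK.
Qed.

(** Unfolds the nested existentials into sequences. The sequence [r] starts one term after [r0],
    whence the shifted vanishing bound and the separate clause for [p = 0]. *)
Lemma resolvable_chain p r0 m (M : 'M[R]_(r0, m)) :
  resolvable p M ->
  exists (r : nat -> nat) (N : 'M[R]_(r 0, r0))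
         (d : forall i, 'M[R]_(r i.+1, r i)),
    [/\ p = 0%N -> r0 = 0%N, forall i, (p <= i.+1)%N -> r i = 0%N,
        syzygy N M, syzygy (d 0%N) N & forall i, syzygy (d i.+1) (d i)].
Proof.
elim: p r0 m M => [|p IHp] r0 m M /=.
  move=> r00; exists (fun=> 0%N), 0, (fun=> 0).
  have syz0 s (X : 'M[R]_(0, s)) : syzygy (0 : 'M[R]_0) X.
    by move=> v; rewrite (thinmx0 v) mul0mx; split=> // _; exists 0;
      rewrite mulmx0.
  split=> //; subst r0; move=> v.
  by rewrite (thinmx0 v) mul0mx; split=> // _; exists 0; rewrite mulmx0.
case=> s [N1 [N1M /IHp [r [N [d [s0 r0E NN1 d0 dS]]]]]].
pose r' i := if i is j.+1 then r j else s.
pose d' i : 'M[R]_(r' i.+1, r' i) :=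
  match i return 'M[R]_(r' i.+1, r' i) with 0 => N | j.+1 => d j end.
exists r', N1, d'; split=> //.
  by case=> [|i]; rewrite ltnS; [rewrite leqn0 => /eqP | apply: r0E].
by case.
Qed.

End Resolutions.

(** * Monomial ideals and splitting along a variable *)

Section MonomialIdeals.
Variables (k : fieldType) (n : nat).
Local Notation S := {mpoly k[n]}.
Implicit Types (U : pred 'X_{1..n}) (f g : S) (x : 'I_n).

(* Monomial ideals are encoded by their up-sets of exponent vectors. *)
Definition up_closed U : Prop := forall m1 m2, U m1 -> U (m1 + m2)%MM.

Definition in_monomial_ideal U f : Prop := forall m, ~~ U m -> f@_m = 0.

Definition monomial_pd_le U p : Prop :=
  exists r (g : 'M[S]_(r, 1)),
    (forall f, in_monomial_ideal U f <->
               exists v : 'rV_r, f = (v *m g) 0 0) /\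
    resolvable p g.

Lemma in_monomial_idealM U f g :
  up_closed U -> in_monomial_ideal U f -> in_monomial_ideal U (g * f).
Proof.
move=> upU Uf m nUm; rewrite mulrC mcoeffM big1 // => kk /eqP mE.
rewrite Uf ?mul0r //; apply: contra nUm => Uk1.
by rewrite mE; apply: upU.
Qed.

Lemma in_monomial_ideal_ind U (Q : S -> Prop) :
  Q 0 -> (forall f g, Q f -> Q g -> Q (f + g)) ->
  (forall c m, U m -> Q (c *: 'X_[m])) ->
  forall f, in_monomial_ideal U f -> Q f.
Proof.
move=> Q0 QD QX f Uf; rewrite [f]mpolyE; apply: big_ind => // m _.
by have [/QX // | /Uf ->] := boolP (U m); rewrite scale0r.
Qed.

Lemma in_monomial_idealZX U c m :
  U m -> in_monomial_ideal U (c *: 'X_[m]).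
Proof.
move=> Um m' nUm'; rewrite mcoeffZ mcoeffX.
by case: eqP => [mE|_]; rewrite ?mulr0 //; rewrite -mE Um in nUm'.
Qed.

Lemma eq_monomial_pd_le U V p :
  U =1 V -> monomial_pd_le U p -> monomial_pd_le V p.
Proof.
move=> UV [r [g [gU resg]]]; exists r, g; split=> // f; rewrite -gU.
by split=> h m; [rewrite UV | rewrite -UV]; apply: h.
Qed.

Lemma monomial_pd_leW U p q :
  (p <= q)%N -> monomial_pd_le U p -> monomial_pd_le U q.
Proof.
by move=> pq [r [g [gU /(resolvable_leq pq)]]]; exists r, g.
Qed.

Lemma monomial_pd_le0 : monomial_pd_le pred0 0.
Proof.
exists 0%N, 0; split=> // f; split=> [f0|[v ->]] //.
  by exists 0; rewrite mulmx0 mxE; apply/mpolyP => m; rewrite mcoeff0 f0.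
by move=> m _; rewrite mulmx0 mxE mcoeff0.
Qed.

(** The unit ideal costs 1 although its quotient is zero: the term [S] in degree 0 is fixed, so one
    generator is needed to cancel it. *)
Lemma monomial_pd_leT : monomial_pd_le predT 1.
Proof.
exists 1%N, 1%:M; split=> [f|].
  by split=> // _; exists f%:M; rewrite mulmx1 mxE.
exists 0%N, 0; split=> // v; rewrite mulmx1; split=> [->|[w ->]].
  by exists 0; rewrite mulmx0.
by rewrite mulmx0.
Qed.

Definition zero_exponent x (m : 'X_{1..n}) : 'X_{1..n} :=
  [multinom if i == x then 0%N else m i | i < n].

Lemma zero_exponentD1 x m : zero_exponent x (m + U_(x)) = zero_exponent x m.
Proof.
apply/mnmP => i; rewrite !mnmE; case: (altP (i =P x)) => // ix.
by rewrite eq_sym (negbTE ix) addn0.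
Qed.

Lemma zero_exponentK x (m : 'X_{1..n}) : m x = 0%N -> zero_exponent x m = m.
Proof. by move=> mx; apply/mnmP => i; rewrite mnmE; case: eqP => // ->. Qed.

Lemma zero_exponentW U x m : up_closed U -> U (zero_exponent x m) -> U m.
Proof.
move=> upU /upU -/(_ (m - zero_exponent x m)%MM); congr (U _).
by apply/mnmP => i; rewrite !mnmE; case: eqP => _;
  rewrite ?subn0 // subnn addn0.
Qed.

(* The two hypotheses bound the projective dimensions of the colon ideal by
   [x] and of the ideal obtained by discarding the multiples of [x]. *)
Lemma monomial_pd_le_colon U x p :
  up_closed U ->
  monomial_pd_le (fun m => U (m + U_(x))%MM) p.+1 ->
  monomial_pd_le (fun m => U (zero_exponent x m)) p ->
  monomial_pd_le U p.+1.
Proof.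
move=> upU [rA [gA [genA resA]]] [rB [gB [genB resB]]].
have mem_im r (g : 'M[S]_(r, 1)) (v : 'rV_r) f :
    f = (v *m g) 0 0 -> f%:M = v *m g.
  by move=> ->; rewrite -mx11_scalar.
exists (rB + rA)%N, (col_mx gB ('X_x *: gA)); split; last first.
  apply: resolvable_colon => //.
  - by apply/lregP; rewrite -msupp_eq0 msuppX.
  - apply: row_factor => i.
    have /genB : exists v : 'rV_rB, gB i 0 = (v *m gB) 0 0.
      by exists (delta_mx 0 i); rewrite -rowE mxE.
    move=> gBi; have /genA [w wE] :
      in_monomial_ideal (fun m => U (m + U_(x))%MM) (gB i 0).
      by move=> m nU; apply: gBi; apply: contra nU => /(zero_exponentW upU)/upU.
    by exists w; rewrite -(mem_im _ _ _ _ wE); apply/rowP => j;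
      rewrite ord1 !mxE.
  - move=> v u vE; set f := (u *m gA) 0 0.
    have /genB fX : exists v : 'rV_rB, f * 'X_x = (v *m gB) 0 0.
      by exists v; rewrite vE mxE mulrC.
    (* Membership in the ideal of [gB] ignores the exponent of [x], so [x] can be cancelled. *)
    have /genB [w wE] : in_monomial_ideal (fun m => U (zero_exponent x m)) f.
      move=> m nU; rewrite -(mcoeffMX f U_(x)) addmC fX //.
      by rewrite zero_exponentD1.
    by exists w; rewrite -(mem_im _ _ _ _ wE) -mx11_scalar.
move=> f; split=> [|[v ->]].
  move: f; apply: in_monomial_ideal_ind.
  - by exists 0; rewrite mul0mx mxE.
  - by move=> f g [v ->] [w ->]; exists (v + w); rewrite mulmxDl [RHS]mxE.
  (* A monomial free of [x] comes from [gB]; any other is [x] times a monomial of the colon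
     ideal. *)
  move=> c m Um; have [mx|mx] := posnP (m x).
    have /genB [v vE] : in_monomial_ideal (fun m => U (zero_exponent x m))
                          (c *: 'X_[m]).
      by apply: in_monomial_idealZX; rewrite zero_exponentK.
    by exists (row_mx v 0); rewrite mul_row_col mul0mx addr0.
  have mE : (m - U_(x) + U_(x) = m)%MM.
    by apply/submK/mnm_lepP => i; rewrite mnm1E; case: eqP => // <-.
  have /genA [v vE] : in_monomial_ideal (fun m => U (m + U_(x))%MM)
                        (c *: 'X_[m - U_(x)]).
    by apply: in_monomial_idealZX; rewrite mE.
  exists (row_mx 0 v); rewrite mul_row_col mul0mx add0r -scalemxAr mxE -vE.
  by rewrite -scalerAr -mpolyXD addmC mE.
have -> : (v *m col_mx gB ('X_x *: gA)) 0 0 =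
          (lsubmx v *m gB) 0 0 + 'X_x * (rsubmx v *m gA) 0 0.
  rewrite -{1}[v]hsubmxK mul_row_col -scalemxAr [LHS]mxE; congr (_ + _).
  by rewrite [LHS]mxE.
move=> m nU; rewrite mcoeffD.
have /genB fB :
    exists w : 'rV_rB, (lsubmx v *m gB) 0 0 = (w *m gB) 0 0 by eexists.
have /genA fA :
    exists w : 'rV_rA, (rsubmx v *m gA) 0 0 = (w *m gA) 0 0 by eexists.
rewrite fB ?add0r; last by apply: contra nU => /(zero_exponentW upU).
have [mx|mx] := posnP (m x).
  rewrite mulrC mcoeffM big1 // => kk /eqP mE.
  rewrite mcoeffX; case: eqP => [kE|_]; last by rewrite mulr0.
  by have := congr1 (fun m' : 'X_{1..n} => m' x) mE;
    rewrite mnmDE -kE mnm1E eqxx mx addn1.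
have mE : (U_(x) + (m - U_(x)) = m)%MM.
  by rewrite addmC; apply/submK/mnm_lepP => i; rewrite mnm1E;
    case: eqP => // <-.
by rewrite -mE mulrC mcoeffMX fA // addmC mE.
Qed.

End MonomialIdeals.

(** * Edge ideals of induced subgraphs, with extra variables *)

Section EdgeIdeals.
Variables (k : fieldType) (n : nat) (e : rel 'I_n).
Hypotheses (e_sym : symmetric e) (e_irr : irreflexive e).
Implicit Types (Z W : {set 'I_n}) (m : 'X_{1..n}) (x z : 'I_n).

(* Exponents of the ideal generated by the variables in [Z] and the edges of
   the subgraph induced on [W]. *)
Definition edge_upset Z W : pred 'X_{1..n} := fun m =>
  [exists z in Z, 0 < m z]%N ||
  [exists i in W, [exists j in W, [&& e i j, 0 < m i & 0 < m j]]]%N.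

Lemma edge_upsetP Z W m :
  reflect ((exists2 z, z \in Z & 0 < m z)%N \/
           exists i j, [/\ i \in W, j \in W, e i j, 0 < m i & 0 < m j]%N)
          (edge_upset Z W m).
Proof.
apply: (iffP orP) => -[h|h]; [left|right|left|right].
- by have [z /andP[zZ mz]] := existsP h; exists z.
- have [i /andP[iW /existsP[j /andP[jW /and3P[eij mi mj]]]]] := existsP h.
  by exists i, j.
- by case: h => z zZ mz; apply/existsP; exists z; rewrite zZ.
- case: h => i [j [iW jW eij mi mj]]; apply/existsP; exists i; rewrite iW.
  by apply/existsP; exists j; rewrite jW eij mi.
Qed.

Lemma edge_upset_up_closed Z W : up_closed (edge_upset Z W).
Proof.
move=> m1 m2 /edge_upsetP h; apply/edge_upsetP.
case: h => [[z zZ mz]|[i [j [iW jW eij mi mj]]]]; [left|right].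
  by exists z; rewrite // mnmDE addn_gt0 mz.
by exists i, j; rewrite !mnmDE !addn_gt0 mi mj.
Qed.

Lemma zero_exponent_gt0 x z m :
  (0 < zero_exponent x m z)%N = (z != x) && (0 < m z)%N.
Proof. by rewrite mnmE; case: eqP. Qed.

Lemma addU_gt0 x z m : (0 < (m + U_(x))%MM z)%N = (x == z) || (0 < m z)%N.
Proof. by rewrite mnmDE mnm1E; case: eqP; rewrite ?addn1 ?addn0. Qed.

(** The colon by [z] is the unit ideal, and discarding the multiples of [z] gives back the ideal of
    [Z] and [W]; hence a fresh variable costs one. *)
Lemma edge_pd_le_variable Z W z p :
  z \notin Z -> z \notin W ->
  monomial_pd_le k (edge_upset Z W) p ->
  monomial_pd_le k (edge_upset (z |: Z) W) p.+1.
Proof.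
move=> nzZ nzW pdZ; apply: (monomial_pd_le_colon (x := z)).
- exact: edge_upset_up_closed.
- apply: (monomial_pd_leW (ltn0Sn p)).
  apply: eq_monomial_pd_le (monomial_pd_leT k n) => m; apply/esym/edge_upsetP.
  by left; exists z; rewrite ?setU11 // addU_gt0 eqxx.
apply: eq_monomial_pd_le pdZ => m.
apply/edge_upsetP/edge_upsetP => -[[i iZ mi]|[i [j [iW jW eij mi mj]]]].
- left; exists i; first by rewrite in_setU1 iZ orbT.
  by rewrite zero_exponent_gt0 mi andbT; apply: contraNneq nzZ => <-.
- right; exists i, j; rewrite !zero_exponent_gt0 mi mj !andbT.
  by split=> //; apply: contraNneq nzW => <-.
- move: mi iZ; rewrite zero_exponent_gt0 in_setU1 => /andP[/negbTE -> mi] iZ.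
  by left; exists i.
- move: mi mj; rewrite !zero_exponent_gt0 => /andP[_ mi] /andP[_ mj].
  by right; exists i, j.
Qed.

Lemma edge_pd_le_variables Z W p :
  [disjoint Z & W] -> monomial_pd_le k (edge_upset set0 W) p ->
  monomial_pd_le k (edge_upset Z W) (#|Z| + p).
Proof.
move=> + pdW; move cE: #|Z| => c.
elim: c Z cE => [|c IHc] Z cE dZW.
  by rewrite (cards0_eq cE).
have /card_gt0P[z zZ] : (0 < #|Z|)%N by rewrite cE.
rewrite -(setD1K zZ) addSn; apply: edge_pd_le_variable.
- by rewrite setD11.
- by rewrite (disjointFr dZW).
apply: IHc; first by have := cardsD1 z Z; rewrite cE zZ => -[].
exact: disjointWl (subD1set _ _) dZW.
Qed.

Definition nbrs W x : {set 'I_n} := [set z in W | e x z].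

Lemma edge_pd_le_vertex W x a b p :
  x \in W ->
  monomial_pd_le k (edge_upset set0 (W :\ x :\: nbrs W x)) a ->
  monomial_pd_le k (edge_upset set0 (W :\ x)) b ->
  (#|nbrs W x| + a <= p.+1)%N -> (b <= p)%N ->
  monomial_pd_le k (edge_upset set0 W) p.+1.
Proof.
move=> xW pdA pdB le_a le_b; apply: (monomial_pd_le_colon (x := x)).
- exact: edge_upset_up_closed.
- apply: (monomial_pd_leW le_a).
  have dN : [disjoint nbrs W x & W :\ x :\: nbrs W x].
    by rewrite -setI_eq0; apply/eqP/setP => z; rewrite !inE; case: (z \in W);
      case: (e x z); rewrite ?andbF.
  apply: eq_monomial_pd_le (edge_pd_le_variables dN pdA) => m.
  apply/edge_upsetP/edge_upsetP => -[[i iZ mi]|[i [j [iW jW eij mi mj]]]].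
  + move: iZ; rewrite inE => /andP[iW exi]; right; exists x, i.
    by rewrite !addU_gt0 eqxx mi orbT.
  + right; exists i, j; rewrite !addU_gt0 mi mj !orbT.
    by move: iW jW; rewrite !inE => /and3P[_ _ ->] /and3P[_ _ ->].
  + by rewrite inE in iZ.
  + move: mi mj; rewrite !addU_gt0.
    case: (altP (x =P i)) => [xi _|xi mi].
      case: (altP (x =P j)) => [xj|_ mj]; first by rewrite -xi -xj e_irr in eij.
      by left; exists j; rewrite // inE jW xi.
    case: (altP (x =P j)) => [xj _|xj mj].
      by left; exists i; rewrite // inE iW xj e_sym.
    (* An edge with an end among the neighbours of [x] is absorbed by that variable. *)
    have [iN|iN] := boolP (i \in nbrs W x); first by left; exists i.
    have [jN|jN] := boolP (j \in nbrs W x); first by left; exists j.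
    right; exists i, j; split=> //.
      by rewrite in_setD iN in_setD1 eq_sym xi.
    by rewrite in_setD jN in_setD1 eq_sym xj.
apply: eq_monomial_pd_le (monomial_pd_leW le_b pdB) => m.
apply/edge_upsetP/edge_upsetP => -[[i]|]; rewrite ?inE //.
  case=> i [j [/setD1P[ix iW] /setD1P[jx jW] eij mi mj]].
  by right; exists i, j; rewrite !zero_exponent_gt0 ix jx.
case=> i [j [iW jW eij]]; rewrite !zero_exponent_gt0.
move=> /andP[ix mi] /andP[jx mj].
by right; exists i, j; rewrite !in_setD1 ix jx.
Qed.

Lemma edge_pd_le_isolated W x p :
  nbrs W x = set0 -> monomial_pd_le k (edge_upset set0 (W :\ x)) p ->
  monomial_pd_le k (edge_upset set0 W) p.
Proof.
move=> /setP N0; apply: eq_monomial_pd_le => m.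
apply/edge_upsetP/edge_upsetP => -[[i]|]; rewrite ?inE //.
  case=> i [j [/setD1P[ix iW] /setD1P[jx jW] eij mi mj]].
  by right; exists i, j.
case=> i [j [iW jW eij mi mj]]; right; exists i, j; split=> //.
  by rewrite in_setD1 iW andbT; apply: contraTneq eij => ->; have := N0 j;
    rewrite !inE jW /= => ->.
rewrite in_setD1 jW andbT; apply: contraTneq eij => ->.
by have := N0 i; rewrite !inE iW e_sym /= => ->.
Qed.

Lemma edge_pd_le_set0 : monomial_pd_le k (edge_upset set0 set0) 0.
Proof.
apply: eq_monomial_pd_le (monomial_pd_le0 k n) => m; apply/esym/edge_upsetP.
by case=> [[z]|[i [j []]]]; rewrite inE.
Qed.

Lemma in_edge_idealE (f : {mpoly k[n]}) :
  in_edge_ideal e f <-> in_monomial_ideal (edge_upset set0 setT) f.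
Proof.
split=> [[c ->]|].
  move=> m nU; rewrite raddf_sum big1 // => i _.
  rewrite raddf_sum big1 // => j eij; rewrite -mulrA -mpolyXD.
  suff : in_monomial_ideal (edge_upset set0 setT)
           (c i j * 'X_[k, U_(i) + U_(j)]) by apply.
  apply: in_monomial_idealM; first exact: edge_upset_up_closed.
  rewrite -['X_[_]]scale1r; apply: in_monomial_idealZX; apply/edge_upsetP.
  by right; exists i, j; rewrite !inE !mnmDE !mnm1E !eqxx addn1.
move: f; apply: in_monomial_ideal_ind.
- by exists (fun _ _ => 0); rewrite big1 // => i _; rewrite big1 // => j _;
  rewrite !mul0r.
- move=> f g [c ->] [d ->]; exists (fun i j => c i j + d i j).
  rewrite -big_split; apply: eq_bigr => i _; rewrite -big_split.
  by apply: eq_bigr => j _; rewrite !mulrDl.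
move=> c m /edge_upsetP [[z]|]; rewrite ?inE // => -[i [j [_ _ eij mi mj]]].
(* Irreflexivity gives [i <> j], so positive exponents at both suffice for divisibility by the
   product. *)
have mE : (m - (U_(i) + U_(j)) + (U_(i) + U_(j)) = m)%MM.
  apply/submK/mnm_lepP => z; rewrite mnmDE !mnm1E.
  have [iz|iz] := eqVneq i z; last by case: eqP => // <-.
  by rewrite -iz; case: eqP => // ji; rewrite ji e_irr in eij.
exists (fun i' j' => if (i' == i) && (j' == j) then
                       c *: 'X_[m - (U_(i) + U_(j))] else 0).
rewrite (bigD1 i) //= [X in _ + X]big1 ?addr0; last first.
  move=> i' /negbTE i'i; rewrite big1 // => j' _.
  by rewrite i'i !mul0r.
rewrite (bigD1 j) //= [X in _ + X]big1 ?addr0; last first.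
  by move=> j' /andP[_ /negbTE j'j]; rewrite j'j andbF !mul0r.
by rewrite !eqxx -mulrA -mpolyXD -scalerAl -mpolyXD mE.
Qed.

Lemma pd_le_monomial p :
  monomial_pd_le k (edge_upset set0 setT) p -> pd_le k e p.
Proof.
case=> r0 [g [gU /resolvable_chain [r [N [d [p0 rE syzN syzd syzS]]]]]].
pose r' i := if i is j.+1 then r j else r0.
pose d' i : 'M[{mpoly k[n]}]_(r' i.+1, r' i) :=
  match i return 'M[{mpoly k[n]}]_(r' i.+1, r' i) with
  | 0 => N | j.+1 => d j end.
have syz' i : syzygy (d' i.+1) (d' i) by case: i.
exists r', g, d'; split; first by case=> [|i]; [rewrite leqn0 => /eqP |
  apply: rE].
split; first by move=> f; rewrite in_edge_idealE gU.
split; first exact: syzygy_mul0.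
split; first by move=> i; apply: syzygy_mul0.
by split=> [v /syzN //|i v /syz'].
Qed.

End EdgeIdeals.

(** * Unit steps and directions in the integer lattice *)

Section Lattice.
Variable l : nat.
Implicit Types (p q : {ffun 'I_l -> int}) (cb : 'I_l * bool).

Definition shift p cb : {ffun 'I_l -> int} :=
  [ffun j => p j + (if j == cb.1 then (if cb.2 then 1 else -1) else 0)].

(** A nonzero integer square is at least 1, so a single coordinate exhausts the sum. *)
Lemma lattice_adj_shift p q : lattice_adj p q -> exists cb, q = shift p cb.
Proof.
rewrite /lattice_adj => /eqP sum1.
have [c pqc] : exists c, p c - q c != 0.
  apply/existsP; rewrite -[X in is_true X]negbK negb_exists.
  apply/negP => /forallP all0; move: sum1; rewrite big1 // => c _.
  by have := all0 c; rewrite negbK => /eqP ->.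
have sq_ge0 j : 0 <= (p j - q j) ^+ 2 by apply: sqr_ge0.
have restE := sum1; rewrite (bigD1 c) //= in restE.
have rest_ge0 : 0 <= \sum_(j < l | j != c) (p j - q j) ^+ 2.
  by apply: sumr_ge0 => j _.
have sqc : (p c - q c) ^+ 2 = 1.
  apply/eqP; rewrite eq_le -{1}restE lerDl rest_ge0 /=.
  by rewrite -gtz0_ge1 lt_def sq_ge0 sqrf_eq0 pqc.
have rest0 : \sum_(j < l | j != c) (p j - q j) ^+ 2 = 0.
  by apply: (addrI 1); rewrite -{1}sqc restE addr0.
exists (c, q c == p c + 1); apply/ffunP => j; rewrite ffunE /=.
case: (altP (j =P c)) => [->|jc].
  case: eqP => // qc; move/eqP: sqc; rewrite sqrf_eq1 => /orP[] /eqP pq.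
    by rewrite -pq opprB addrC subrK.
  by case: qc; rewrite -[1]opprK -pq opprB addrC subrK.
have /eqP := psumr_eq0P (fun i _ => sq_ge0 i) rest0 jc.
by rewrite sqrf_eq0 subr_eq0 addr0 => /eqP ->.
Qed.

(* The weights decrease strictly, so moving by e_j - e_c increases the height
   whenever j < c. *)
Definition height p : int := \sum_(c < l) (l - c)%:Z * p c.

Lemma height_shift p cb :
  height (shift p cb) =
  height p + (if cb.2 then (l - cb.1)%:Z else - (l - cb.1)%:Z).
Proof.
rewrite /height [in LHS](bigD1 cb.1) // [in RHS](bigD1 cb.1) //=.
rewrite ffunE eqxx mulrDr -!addrA; congr (_ + _); rewrite addrC.
congr (_ + _); last by case: cb.2; rewrite ?mulrN mulr1.
by apply: eq_bigr => j /negbTE jc; rewrite ffunE jc addr0.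
Qed.

(** Since [pos] is injective, each direction from [p] reaches at most one vertex; neighbours can be
    counted by their directions. *)
Lemma card_shifts n (pos : 'I_n -> {ffun 'I_l -> int}) (N : {set 'I_n}) p
    (D : {set 'I_l * bool}) :
  injective pos ->
  (forall z, z \in N -> exists2 cb, cb \in D & pos z = shift p cb) ->
  (#|N| <= #|D|)%N.
Proof.
move=> pos_inj shiftN.
pose f cb := [pick z | pos z == shift p cb].
rewrite -(card_imset _ (@Some_inj _)); apply: leq_trans (leq_imset_card f D).
apply: subset_leq_card; apply/subsetP => _ /imsetP[z zN ->].
have [cb cbD zE] := shiftN z zN; apply/imsetP; exists cb => //.
rewrite /f; case: pickP => [z' /eqP|/(_ z)]; last by rewrite zE eqxx.
by rewrite -zE => /pos_inj ->.
Qed.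

Lemma card_directions (b : bool) c :
  (c <= l)%N -> #|[set cb : 'I_l * bool | (cb.1 < c)%N && (cb.2 == b)]| = c.
Proof.
move=> cl; pose f (i : 'I_c) := (widen_ord cl i, b).
have f_inj : injective f by move=> i j [/ord_inj ij].
rewrite -[RHS]card_ord -(card_imset _ f_inj); apply: eq_card => -[j b'].
rewrite !inE /=; apply/andP/imsetP => [[jc /eqP ->]|[i _ [-> ->]]] //=.
exists (Ordinal jc) => //; congr (_, _); exact: val_inj.
Qed.

End Lattice.

(** * The numerical balance and the induction on vertex sets *)

Lemma ratio_step d p r v w :
  (r <= d)%N -> (v + r.+1 = w)%N -> ((d + 1) * p <= d * v)%N ->
  ((d + 1) * (p + r) <= d * w)%N.
Proof.
(* The extra cost is covered because [(d + 1) r <= d (r + 1)] amounts to [r <= d]. *)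
move=> le_rd <- le_pv; rewrite !mulnDr leq_add // mulnS mulnDl mul1n addnC.
by rewrite leq_add2r.
Qed.

(* G: vertices 'I_n embedded injectively into Z^l by pos; edges e form a
   simple graph whose edges are lattice edges. pd(G) <= n(1 - 1/(2l+1))
   is written (2l+1) * pd <= 2l * n. *)
Theorem theorem3p7 (k : fieldType) (l n : nat) (hl : (1 <= l)%N)
  (pos : 'I_n -> {ffun 'I_l -> int}) (pos_inj : injective pos)
  (e : rel 'I_n) (e_sym : symmetric e) (e_irr : irreflexive e)
  (e_lat : forall i j, e i j -> lattice_adj (pos i) (pos j)) :
  exists p : nat, pd_le k e p /\ ((2 * l + 1) * p <= 2 * l * n)%N.
Proof.
pose good (W : {set 'I_n}) p := monomial_pd_le k (edge_upset e set0 W) p.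
suff main (W : {set 'I_n}) :
    exists p, good W p /\ ((2 * l + 1) * p <= 2 * l * #|W|)%N.
  have [p [/(pd_le_monomial e_irr) pdp le_p]] := main setT.
  by exists p; rewrite cardsT card_ord in le_p.
move wE: #|W| => w; elim/ltn_ind: w W wE => w IHw W wE.
have [W0|[y0 y0W]] := set_0Vmem W.
  by exists 0%N; rewrite muln0 /good W0; split=> //; apply: edge_pd_le_set0.
pose y := [arg max_(y > y0 in W) height (pos y)]%O.
have [yW ymax] :
    y \in W /\ forall z, z \in W -> height (pos z) <= height (pos y).
  by rewrite /y; case: Order.TotalTheory.arg_maxP.
have nbr_y z : z \in W -> e y z -> exists c, pos z = shift (pos y) (c, false).
  move=> zW /e_lat /lattice_adj_shift [[c [] zE]]; last by exists c.
  have := ymax z zW; rewrite zE height_shift /= gerDl.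
  by rewrite lez_nat leqn0 subn_eq0 leqNgt ltn_ord.
pose removed c := [set z in W | e y z &
  [exists i : 'I_l, (i < c)%N && (pos z == shift (pos y) (i, false))]].
have card_removed c : (c <= l)%N -> (#|removed c| <= c)%N.
  move=> cl; rewrite -[X in (_ <= X)%N](card_directions false cl).
  apply: (card_shifts (p := pos y) pos_inj) => z;
    rewrite inE => /and3P[_ _ /existsP[i /andP[ic /eqP zE]]].
  by exists (i, false); rewrite ?inE ?ic.
have yR c : y \notin removed c by rewrite inE e_irr andbF.
have RW c : removed c \subset W by apply/subsetP => z; rewrite inE => /andP[].
have card_rem c : (#|W :\: removed c| = w - #|removed c|)%N.
  by rewrite cardsD (setIidPr (RW c)) wE.
have card_Rlt c : (#|removed c| < w)%N.
  by rewrite -wE; apply: proper_card; apply/properP; split=> //; exists y.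
(* Each deleted neighbour of [y] is charged one unit; at [c = 0] nothing is deleted and the claim
   for [W] remains. *)
suff stage c : (c <= l)%N -> exists p,
    good (W :\: removed c) p /\
    ((2 * l + 1) * (p + #|removed c|) <= 2 * l * w)%N.
  have [|p [pdp le_p]] := stage 0%N; first by [].
  have R0 : removed 0%N = set0.
    by apply/setP => z; rewrite !inE; apply/negP => /and3P[_ _ /existsP[i]].
  by exists p; move: pdp le_p; rewrite R0 setD0 cards0 addn0.
(* Descending induction on [c] from [l], carried out on [d = l - c]. *)
move=> cl; rewrite -(subKn cl); move: (l - c)%N (leq_subr c l) => d {c cl}.
elim: d => [|d IHd] dl.
  rewrite subn0; set R := removed l.
  have y_iso : nbrs e (W :\: R) y = set0.
    apply/setP => z; rewrite !inE; apply/negP => /andP[/andP[nR zW] eyz].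
    case/negP: nR; rewrite zW eyz; have [c zE] := nbr_y z zW eyz.
    by apply/existsP; exists c; rewrite ltn_ord zE /=.
  have [|p [pdp le_p]] := IHw _ _ (W :\: R :\ y) erefl.
    have := cardsD1 y (W :\: R); rewrite card_rem in_setD yR yW /=.
    have := card_Rlt l; rewrite -/R; lia.
  exists p; split; first exact: edge_pd_le_isolated y_iso pdp.
  (* Here [r] is the size of [R], at most [l], and the vertices gone are [R] and [y]. *)
  apply: ratio_step le_p; first by have := card_removed l (leqnn l);
    rewrite -/R; lia.
  have := cardsD1 y (W :\: R); rewrite card_rem in_setD yR yW /=.
  have := card_Rlt l; rewrite -/R; lia.
have cl : (l - d.+1 < l)%N by lia.
have {IHd} [|p [pdp le_p]] := IHd; first exact: ltnW.
set c := (l - d.+1)%N in cl *.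
have cS : (l - d)%N = c.+1 by rewrite /c; lia.
rewrite cS in pdp le_p.
pose oc := Ordinal cl.
have [/existsP[x /and3P[xW eyx /eqP xE]]|none] :=
  boolP [exists x, [&& x \in W, e y x & pos x == shift (pos y) (oc, false)]];
    last first.
  (* Without a neighbour of [y] at [y - e_c], two consecutive stages coincide. *)
  exists p; suff -> : removed c = removed c.+1 by [].
  apply/setP => z; rewrite !inE; case zW: (z \in W) => //=;
    case eyz: (e y z) => //=.
  apply: eq_existsb => i; rewrite ltnS [in RHS]leq_eqVlt;
    case: (altP (i =P c :> nat)) => //= ic.
  rewrite ic ltnn /=; apply/esym/negP => /eqP zE; case/negP: none.
  apply/existsP; exists z; rewrite zW eyz zE /=; apply/eqP;
    congr (shift _ (_, _)).
  exact: val_inj.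
have shift_neq (i : 'I_l) :
  (i < c)%N -> shift (pos y) (i, false) <> shift (pos y) (oc, false).
  move=> ic /ffunP/(_ i); rewrite !ffunE /= eqxx -val_eqE /= (ltn_eqF ic).
  by move/addrI.
have xR : x \notin removed c.
  rewrite inE; apply/negP => /and3P[_ _ /existsP[i /andP[ic /eqP]]].
  by rewrite xE => /esym; apply: shift_neq.
have RS : removed c.+1 = x |: removed c.
  apply/setP => z; rewrite !inE;
    apply/and3P/orP => [[zW eyz /existsP[i /andP[ic /eqP zE]]]|].
    move: ic; rewrite ltnS leq_eqVlt => /orP[/eqP ic|ic]; [left|right].
      apply/eqP/pos_inj; rewrite zE xE; congr (shift _ (_, _)); exact: val_inj.
    by rewrite zW eyz; apply/existsP; exists i; rewrite ic zE /=.
  case=> [/eqP ->|/and3P[-> -> /existsP[i /andP[ic zE]]]]; split=> //;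
    apply/existsP.
    by exists oc; rewrite /= ltnS leqnn xE /=.
  by exists i; rewrite (leq_trans ic (leqnSn c)).
set R := removed c in xR RS *.
have WS : W :\: removed c.+1 = W :\: R :\ x.
  by rewrite RS setUC setDDl.
have xWR : x \in W :\: R by rewrite in_setD xR.
have cardRS : #|removed c.+1| = #|R|.+1 by rewrite RS cardsU1 xR.
have Rc : (#|R| <= c)%N by apply: card_removed; apply: ltnW.
set N := nbrs e (W :\: R) x.
have cardN : (#|N| + c <= 2 * l)%N.
  (* The directions [+e_i] with [i < c] are forbidden: from [x = y - e_c] they lead strictly higher
     than [y]. *)
  pose F := [set cb : 'I_l * bool | (cb.1 < c)%N && (cb.2 == true)].
  have : (#|N| <= #|~: F|)%N.
    apply: (card_shifts (p := pos x) pos_inj) => z;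
      rewrite inE => /andP[/setDP[zW _] exz].
    have [[i b] zE] := lattice_adj_shift (e_lat _ _ exz); exists (i, b) => //.
    rewrite !inE /= negb_and -leqNgt; case: b zE => zE; rewrite ?orbT ?orbF //.
    have := ymax z zW; rewrite zE xE !height_shift /= -addrA gerDl addrC
      subr_le0.
    by rewrite lez_nat leq_sub2lE //; apply: ltnW.
  have := cardsC F; rewrite card_directions ?(ltnW cl) // card_prod card_ord
    card_bool; lia.
have NW : N \subset W :\: R :\ x.
  apply/subsetP => z; rewrite !inE => /andP[-> exz]; rewrite andbT.
  by apply: contraTneq exz => ->; rewrite e_irr.
have cardWx : (#|W :\: R :\ x| = w - #|R| - 1)%N.
  by have := cardsD1 x (W :\: R); rewrite card_rem xWR -/R; lia.
have cardA : (#|W :\: R :\ x :\: N| = w - #|R| - 1 - #|N|)%N.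
  by rewrite cardsD (setIidPr NW) cardWx.
have [|a [pda le_a]] := IHw _ _ (W :\: R :\ x :\: N) erefl.
  by have := card_Rlt c; rewrite cardA -/R; lia.
exists (maxn (#|N| + a) p.+1); split.
  rewrite WS in pdp; rewrite -[maxn _ _]prednK ?leq_max ?orbT //.
  by apply: (edge_pd_le_vertex e_sym e_irr xWR pda pdp); rewrite -?/N; lia.
have Nle := subset_leq_card NW; rewrite cardWx in Nle.
rewrite cardRS in le_p; rewrite cardA in le_a.
(* If [p.+1] is the maximum, its extra unit is the charge for [x], already counted in [le_p]. *)
have [_|_] := leqP (#|N| + a) p.+1; first by rewrite addSnnS.
(* Otherwise the cost is [r = #|N| + #|R|], at most [(2l - c) + c], and the [r + 1] vertices of [N],
   [R] and [x] disappear. *)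
rewrite (addnC #|N|) -addnA; apply: ratio_step le_a; first by lia.
by have := card_Rlt c; rewrite -/R; lia.
Qed.
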